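(* For every integer $n\geq 2600$, $$\left\lceil \frac{8(n-1)}{17}\right\rceil \;\leq\; f(n)\;\leq\; \left\lceil \frac{8(n-1)}{17}\right\rceil+1 .$$ Moreover, for every integer $n\geq 1$, $$\frac{8(n-1)}{17}-4\;\leq\; f(n)\;\leq\;\frac{8(n-1)}{17}+2 .$$
   Context: For a positive integer $n$, $[n]=\{1,\ldots,n\}$. Colorings may use any number of colors. A rainbow $\mathrm{AP}(3)$ is a three-term arithmetic progression (with nonzero common difference) whose elements have pairwise distinct colors. $f(n)$ is the smallest integer $k$ such that there is a coloring of $[n]$ with largest color class of size $k$ and with no rainbow $\mathrm{AP}(3)$. *)

(* Defs.v *)
From mathcomp Require Import all_boot all_order all_algebra.
From mathcomp Require Import boolp.

Set Implicit Arguments.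
Unset Strict Implicit.
Unset Printing Implicit Defensive.

(* A coloring of [n] = {1, ..., n} is given by c : nat -> nat, of which only
   the values on [n] matter; colors are natural numbers, so that any finite
   number of them is available. *)

Definition interval1 (n : nat) : seq nat := iota 1 n.

Definition rainbow_free (n : nat) (c : nat -> nat) : Prop :=
  ~ exists a d : nat,
      [/\ 0 < d,
          [/\ a \in interval1 n, a + d \in interval1 n
            & a + 2 * d \in interval1 n]
        & [/\ c a <> c (a + d), c a <> c (a + 2 * d)
            & c (a + d) <> c (a + 2 * d)]].

Definition color_class (n : nat) (c : nat -> nat) (x : nat) : seq nat :=
  [seq i <- interval1 n | c i == x].

(* Only the colors occurring on [n] have a nonempty class. *)
Definition largest_class (n : nat) (c : nat -> nat) : nat :=
  \max_(i <- interval1 n) size (color_class n c (c i)).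

Definition attained (n k : nat) : Prop :=
  exists c : nat -> nat, rainbow_free n c /\ largest_class n c = k.

(* Constant colorings have no rainbow AP(3). *)
Lemma ex_attained (n : nat) : exists k : nat, `[< attained n k >].
Proof.
exists (largest_class n (fun=> 0)); apply/asboolP; exists (fun=> 0).
by split=> // -[a [d [_ _ []]]].
Qed.

Definition f (n : nat) : nat := ex_minn (ex_attained n).

(* Main.v *)
Require Import Defs.
From mathcomp Require Import all_boot all_order all_algebra.
From mathcomp Require Import zify lra boolp.

Set Implicit Arguments.
Unset Strict Implicit.
Unset Printing Implicit Defensive.

(** Upper bound. Color the multiples of 17 with one color, the nonzero squares
mod 17 with a second one and the other residues with a third one. The nonzero
squares mod 17 are the group generated by 2, which contains -1 = 2^4; so
doubling a nonzero residue or changing its sign preserves its color, and the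
two other terms of a progression through a multiple of 17 have equal colors
([qr17_rainbow_free]). The two large classes have density 8/17, which gives
17 f(n) <= 8n + 25 ([f_upper]).

Lower bound. Two facts give every rainbow-free coloring a simple shape. Either
some color A occurs in every pair of neighbors of different colors, or two
colors cover all but four points ([dominant_or_two_colors]). Among the colors
other than A, at most one, B, occurs at two consecutive points
([one_doubled_color]). If there is no such B, the points outside A are isolated
and A takes about half of the interval. Otherwise merge the remaining colors
into a color C: its points are isolated, with neighbors in A. If C has at most
(n + 16)/17 points, then A or B has at least 8(n - 1)/17. Otherwise two points
of C lie at distance at most 16. Let g be the least distance between two points
of C, reached by x and x + g.

A progression that has one term in C has its two other terms in the same color
unless one of them is in C; so the coloring is nearly invariant under doubling
distances from x and from x + g, and under reflections in these points. This
forces about half of the interval into A ([tight_gap_count]).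
- If g is odd, exactly one of x and x + g has the parity of a given v, and the
  midpoint of v and that point is outside A when v is in B. Iterating this
  halving moves two nearby points of B into the window between x and x + g,
  where the doublings confine B to the multiples of a divisor m > 1 of g. The
  difference of the two points never becomes a multiple of m, so B has no two
  consecutive points, a contradiction ([odd_gap]). The only window that
  escapes has g = 15; then the coloring has period 15 outside the multiples of
  15, and A contains the eight units mod 15.
- If g is even, halving the distance to x and doubling the distance to x + g
  translates points of B at even distance from x by g. This descent excludes
  g = 2 and g = 4. For larger g, the points outside A at even distance from x
  turn out to be at distance at least 6 from each other, and so do those at odd
  distance from x in the middle half of the interval, because doubling relates
  them to the even ones. So A has about n/3 + n/6 points ([even_gap_count]).

Together, 17 f(n) >= 8(n - 1) or 6 f(n) + 29 >= 3n ([f_lower]); the second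
alternative implies the first one as soon as n >= 149. *)

(** * Counting along intervals *)

Lemma count_iotaS (p : pred nat) n :
  count p (iota 0 n.+1) = count p (iota 0 n) + p n.
Proof. by rewrite -addn1 iotaD count_cat /= addn0. Qed.

Lemma count_iota0 (p : pred nat) m n :
  (forall i, m <= i < m + n -> ~~ p i) -> count p (iota m n) = 0.
Proof.
move=> h; apply/eqP; rewrite -leqn0 leqNgt -has_count.
by apply/hasPn => i; rewrite mem_iota; apply: h.
Qed.

Lemma count_spaced k (p : pred nat) n : 0 < k ->
  (forall i j, i < j -> j < n -> p i -> p j -> i + k <= j) ->
  k * count p (iota 0 n) <= n + k.-1.
Proof.
move=> k0; elim/ltn_ind: n => -[|n] IH h; first by rewrite muln0.
rewrite count_iotaS; case pn: (p n); last first.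
  have := IH n (ltnSn n) (fun i j ij jn => h i j ij (ltnW jn)).
  rewrite addn0; lia.
have -> : count p (iota 0 n) = count p (iota 0 (n - k.-1)).
  rewrite -[n in LHS](@subnKC (n - k.-1)) ?leq_subr // iotaD count_cat add0n.
  rewrite [X in _ + X]count_iota0 ?addn0 // => i hi.
  by apply/negP => pi; have := h i n ltac:(lia) ltac:(lia) pi pn; lia.
case: (leqP k.-1 n) => hk.
  have := IH (n - k.-1) ltac:(lia) (fun i j ij jn => h i j ij ltac:(lia)).
  rewrite mulnDr; lia.
have -> : n - k.-1 = 0 by lia.
by rewrite /= muln1; lia.
Qed.

Lemma count_two_progressions (p : pred nat) N a m1 q m2 : odd (a + q) ->
  (forall j, j < m1 -> a + 2 * j <= N) -> (forall j, j < m2 -> q + 2 * j <= N) ->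
  count (fun j => p (a + 2 * j)) (iota 0 m1) +
  count (fun j => p (q + 2 * j)) (iota 0 m2) <= count p (iota 0 N.+1).
Proof.
move=> aq h1 h2; set s1 := [seq a + 2 * j | j <- iota 0 m1].
set s2 := [seq q + 2 * j | j <- iota 0 m2].
have -> : count (fun j => p (a + 2 * j)) (iota 0 m1) = count p s1 by rewrite count_map.
have -> : count (fun j => p (q + 2 * j)) (iota 0 m2) = count p s2 by rewrite count_map.
rewrite -count_cat -!size_filter; apply: uniq_leq_size.
  apply: filter_uniq; rewrite cat_uniq !map_inj_uniq ?iota_uniq /= ?andbT; last first.
  - by move=> i j; lia.
  - by move=> i j; lia.
  by apply/hasPn => _ /mapP[j _ ->]; apply/mapP => -[i _ e]; move: aq; clear -e; lia.
move=> i; rewrite !mem_filter mem_cat => /andP[-> /orP[] /mapP[j]];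
  rewrite mem_iota add0n => hj ->; rewrite mem_iota ltnS.
  exact: h1.
exact: h2.
Qed.

Lemma count_neg (p : pred nat) n :
  count p (iota 0 n) + count (fun i => ~~ p i) (iota 0 n) = n.
Proof. by rewrite (count_predC p) size_iota. Qed.

Lemma count_three (T : Type) (p1 p2 p3 : pred T) (s : seq T) :
  (forall i, p1 i + p2 i + p3 i = 1) -> count p1 s + count p2 s + count p3 s = size s.
Proof. by move=> h; elim: s => //= i s <-; have := h i; lia. Qed.

Lemma count_interval_but4 (p : pred nat) N :
  (forall i, 1 < i -> i + 2 <= N -> p i) -> N.+1 <= count p (iota 0 N.+1) + 4.
Proof.
move=> h; have [N4|N4] := ltnP N 3; first by lia.
have e : N.+1 = 2 + (N - 3 + 2) by lia.
rewrite [in iota 0 _]e iotaD count_cat iotaD count_cat.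
have all_p : all p (iota 2 (N - 3)).
  by apply/allP => i; rewrite mem_iota => hi; apply: h; lia.
by rewrite (eqP (etrans (esym (all_count p _)) all_p)) ?size_iota; lia.
Qed.

(** * Dominant colors *)

(** Positions are 0, ..., N here, so that reflections and shifts of an interval
are again intervals of this form. The common difference may be 0 or negative. *)
Definition no_rainbow N (c : nat -> nat) : Prop :=
  forall i j k, i + k = 2 * j -> i <= N -> k <= N ->
    c i = c j \/ c j = c k \/ c i = c k.

Lemma no_rainbow_mirror N M c : N <= M ->
  no_rainbow M c -> no_rainbow N (fun i => c (N - i)).
Proof. by move=> NM h i j k *; apply: h; lia. Qed.

Lemma no_rainbow_shift N M x c : x + N <= M ->
  no_rainbow M c -> no_rainbow N (fun i => c (x + i)).
Proof. by move=> NM h i j k *; apply: h; lia. Qed.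

Definition dominates (c : nat -> nat) s t A : Prop :=
  forall i, s <= i < t -> c i = c i.+1 \/ c i = A \/ c i.+1 = A.

(** The shape of a minimal interval without dominant color: among the bichromatic
pairs of neighbors, only the first one avoids P and only the last one avoids Q. *)
Record split_block (c : nat -> nat) s t P Q : Prop := SplitBlock {
  sb_lt : s < t;
  sb_in : forall i, s < i < t -> c i = P \/ c i = Q;
  sb_s : c s <> P /\ c s <> Q;
  sb_t : c t <> P /\ c t <> Q;
  sb_s1 : c s.+1 = Q;
  sb_t1 : c t.-1 = P;
  sb_PQ : P <> Q
}.

(** A point two steps (one step, if t - s is odd) to the left of s is in a
progression with s and one inside the block, and in one with t and the midpoint;
both force it to have the color of s and t. Doubling distances from s and from
that point then carries the color Q of s + 1 along the block up to t - 1 or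
t - 2, which has color P. *)
Lemma split_block_start N c s t P Q :
  no_rainbow N c -> t <= N -> split_block c s t P Q -> s <= 1.
Proof.
move=> ap tN [st inn [sP sQ] [tP tQ] s1 t1 PQ].
have D3 : s + 3 <= t.
  rewrite leqNgt; apply/negP => lt3.
  have [e|e] : t = s.+1 \/ t = s.+2 by lia.
    by subst t; congruence.
  by subst t; move: t1 => /=; congruence.
have dbl j : 0 < j -> s + 2 * j < t -> c (s + 2 * j) = c (s + j).
  move=> j0 jt.
  have := ap s (s + j) (s + 2 * j) ltac:(lia) ltac:(lia) ltac:(lia).
  have := inn (s + j) ltac:(lia); have := inn (s + 2 * j) ltac:(lia); lia.
have s2 : c (s + 2) = Q by have := dbl 1 isT ltac:(lia); rewrite muln1 addn1 s1.
have t2 : c (t - 2) = P.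
  have := ap (t - 2) (t.-1) t ltac:(lia) ltac:(lia) ltac:(lia).
  have := inn (t - 2) ltac:(lia); lia.
rewrite leqNgt; apply/negP => s2le.
have [k [e|e]] : exists k, t = s + 2 * k \/ t = s + 2 * k + 1.
  exists ((t - s)./2); lia.
- have cm : c (s + (k - 1)) = P.
    rewrite -dbl; [|lia|lia]; rewrite -t2; congr c; lia.
  (* The progression ending in t allows P and c t, the other one Q and c s. *)
  have eX : c (s - 2) = c s /\ c (s - 2) = c t.
    have := ap (s - 2) (s + (k - 1)) t ltac:(lia) ltac:(lia) ltac:(lia).
    have := ap (s - 2) s (s + 2) ltac:(lia) ltac:(lia) ltac:(lia).
    lia.
  have evenQ i : 0 < i -> s + 2 * i < t -> c (s + 2 * i) = Q.
    elim/ltn_ind: i => i IH i0 it.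
    case: (ltnP i 2) => i2; first by have -> : 2 * i = 2 by lia.
    have [j [ej|ej]] : exists j, i = 2 * j \/ i = 2 * j + 1.
      exists (i./2); lia.
    + by rewrite dbl // ej; apply: IH; lia.
    + have cj : c (s + 2 * j) = Q by apply: IH; lia.
      have := ap (s - 2) (s + 2 * j) (s + 2 * i) ltac:(lia) ltac:(lia) ltac:(lia).
      have := inn (s + 2 * i) ltac:(lia); lia.
  have := evenQ (k - 1) ltac:(lia) ltac:(lia).
  have -> : s + 2 * (k - 1) = t - 2 by lia.
  lia.
- have cm : c (s + k) = P.
    rewrite -dbl; [|lia|lia]; rewrite -t1; congr c; lia.
  have s1' : c (s + 1) = Q by rewrite addn1.
  have eX : c (s - 1) = c s /\ c (s - 1) = c t.
    have := ap (s - 1) (s + k) t ltac:(lia) ltac:(lia) ltac:(lia).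
    have := ap (s - 1) s (s + 1) ltac:(lia) ltac:(lia) ltac:(lia).
    lia.
  have allQ i : 0 < i -> s + i < t -> c (s + i) = Q.
    elim/ltn_ind: i => i IH i0 it.
    case: (ltnP i 2) => i2; first by have -> : i = 1 by lia.
    have [j [ej|ej]] : exists j, i = 2 * j \/ i = 2 * j + 1.
      exists (i./2); lia.
    + by rewrite ej dbl; [apply: IH; lia|lia|lia].
    + have cj : c (s + j) = Q by apply: IH; lia.
      have := ap (s - 1) (s + j) (s + i) ltac:(lia) ltac:(lia) ltac:(lia).
      have := inn (s + i) ltac:(lia); lia.
  have := allQ (t.-1 - s) ltac:(lia) ltac:(lia).
  have -> : s + (t.-1 - s) = t.-1 by lia.
  lia.
Qed.

Lemma split_block_mirror N c s t P Q : t <= N ->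
  split_block c s t P Q -> split_block (fun i => c (N - i)) (N - t) (N - s) Q P.
Proof.
move=> tN [st inn hs ht s1 t1 PQ].
have eN u i : u <= N -> i = N - u -> c (N - i) = c u.
  by move=> ? ->; congr c; lia.
split=> /=.
- lia.
- by move=> i hi; have := inn (N - i) ltac:(lia); tauto.
- by rewrite (eN t) //; tauto.
- by rewrite (eN s); [tauto|lia|].
- by rewrite (eN t.-1); lia.
- by rewrite (eN s.+1); lia.
- exact: nesym.
Qed.

(** In a minimal undominated interval, removing the last point leaves a
dominant color A2 and removing the first one leaves A1. The first pair of
neighbors avoids A1, the last one avoids A2, and every bichromatic pair between
them is made of A1 and A2. *)
Lemma undominated_split N c s t : no_rainbow N c -> t <= N ->
  s <= t -> ~ (exists A, dominates c s t A) ->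
  exists s' t' P Q, [/\ s <= s', t' <= t & split_block c s' t' P Q].
Proof.
move=> ap; have [L] := ubnP (t - s).
elim: L s t => // L IH s t lt tN st nd.
have [[A1 d1]|n1] := EM (exists A, dominates c s.+1 t A); last first.
  have st' : s < t.
    rewrite ltnNge; apply/negP => ?; apply: nd; exists 0 => i; lia.
  have [||||s' [t' [P [Q [h1 h2 h3]]]]] := IH s.+1 t; rewrite ?tN //; try lia.
  by exists s', t', P, Q; split=> //; lia.
have [[A2 d2]|n2] := EM (exists A, dominates c s t.-1 A); last first.
  have st' : s < t.
    rewrite ltnNge; apply/negP => ?; apply: nd; exists 0 => i; lia.
  have [||||s' [t' [P [Q [h1 h2 h3]]]]] := IH s t.-1; rewrite ?tN //; try lia.
  by exists s', t', P, Q; split=> //; lia.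
have stlt : s < t by rewrite ltnNge; apply/negP => ?; apply: nd; exists 0 => i; lia.
have st2 : s.+1 < t.
  rewrite ltnNge; apply/negP => ?; apply: nd; exists (c s) => i hi.
  have -> : i = s by lia.
  by right; left.
have es : c s <> c s.+1 /\ c s <> A1 /\ c s.+1 <> A1.
  apply: contrapT => h; apply: nd; exists A1 => i hi.
  have [si|si] := ltnP s i; first by apply: d1; lia.
  have -> : i = s by lia.
  lia.
have et : c t.-1 <> c t /\ c t.-1 <> A2 /\ c t <> A2.
  apply: contrapT => h; apply: nd; exists A2 => i hi.
  have [si|si] := ltnP i t.-1; first by apply: d2; lia.
  have -> : i = t.-1 by lia.
  rewrite prednK; lia.
have e1 := d2 s ltac:(lia).
have e2 : c t.-1 = c t \/ c t.-1 = A1 \/ c t = A1.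
  by have := d1 t.-1 ltac:(lia); rewrite prednK; lia.
have PQ : A1 <> A2 by intuition congruence.
have s1 : c s.+1 = A2.
  apply: contrapT => sQ.
  have cst i : s < i < t -> c i = c s.+1.
    elim: i => [|i IHi] hi; first by lia.
    have [<-//|ne] := eqVneq s i.
    have ci : c i = c s.+1 by apply: IHi; lia.
    case: es => _ [_ sP].
    have := d1 i ltac:(lia); have := d2 i ltac:(lia).
    by move=> [?|[?|?]] [?|[?|?]]; congruence.
  apply: nd; exists (c s.+1) => i hi; right.
  have [si|si] := ltnP s i; first by left; apply: cst; lia.
  by right; apply: cst; lia.
have inn i : s < i < t -> c i = A1 \/ c i = A2.
  elim: i => [|i IHi] hi; first by lia.
  have [<-|ne] := eqVneq s i; first by right.
  have := IHi ltac:(lia); have := d1 i ltac:(lia); have := d2 i ltac:(lia).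
  by clear -PQ; move=> [?|[?|?]] [?|[?|?]] [?|?]; intuition congruence.
have t1 : c t.-1 = A1.
  by have := inn t.-1 ltac:(lia); intuition congruence.
by exists s, t, A1, A2; split=> //; split=> //; intuition congruence.
Qed.

(** Some small intervals have no dominant color, for instance XQQPQPPX; but the
block then fills the interval up to one point on either side. *)
Lemma dominant_or_two_colors N c : no_rainbow N c ->
  (exists A, dominates c 0 N A) \/
  exists P Q, forall i, 1 < i -> i + 2 <= N -> c i = P \/ c i = Q.
Proof.
move=> ap; have [?|nd] := EM (exists A, dominates c 0 N A); [by left|right].
have [s [t [P [Q [_ tN sb]]]]] := undominated_split ap (leqnn N) (leq0n N) nd.
exists P, Q => i i1 iN; apply: (sb_in sb).
have := split_block_start ap tN sb.
have := split_block_start (no_rainbow_mirror (leqnn N) ap) (leq_subr _ _)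
  (split_block_mirror tN sb).
have := sb_lt sb; lia.
Qed.

(** * At most one other color occurs twice in a row *)

(** Take a double X and a double Y at least distance. At even distance, the
midpoints of their points form a closer double. At odd distance, a point of
color X between them has a midpoint with the double Y, which has color Y, and
conversely; so two points of the same color between them produce two closer
ones, down to two consecutive points. Going twice through a midpoint yields such
two points. *)
Lemma one_doubled_color N c X Y : no_rainbow N c ->
  (forall i, i < N -> ~ (c i = X /\ c i.+1 = Y) /\ ~ (c i = Y /\ c i.+1 = X)) ->
  X <> Y ->
  forall i j, i < j -> j < N ->
  c i = X -> c i.+1 = X -> c j = Y -> c j.+1 = Y -> False.
Proof.
move=> ap nXY XY i j; have [D] := ubnP (j - i).
elim: D X Y nXY XY i j => // D IH X Y nXY XY i j lt ij jN ci ci1 cj cj1.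
have nYX k : k < N -> ~ (c k = Y /\ c k.+1 = X) /\ ~ (c k = X /\ c k.+1 = Y).
  by move=> /nXY[].
have noX q : i < q -> q < j -> c q = X -> c q.+1 = X -> False.
  by move=> iq qj cq cq1; apply: (IH X Y _ _ q j) => //; lia.
have noY q : i < q -> q < j -> c q = Y -> c q.+1 = Y -> False.
  by move=> iq qj cq cq1; apply: (IH X Y _ _ i q) => //; lia.
have noE q : i < q -> q < j -> c q = X \/ c q = Y -> c q.+1 = X \/ c q.+1 = Y -> False.
  move=> iq qj; have := noX q iq qj; have := noY q iq qj; have := nXY q ltac:(lia).
  by intuition.
have mid a b m : a <= N -> b <= N -> c a = X -> c b = Y -> a + b = 2 * m -> c m = X \/ c m = Y.
  by move=> aN bN ca cb ab; have := ap a m b ab aN bN; lia.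
have [k [ek|ek]] : exists k, j = i + 2 * k \/ j = i + 2 * k + 1.
  by exists ((j - i)./2); lia.
  apply: (noE (i + k)); try lia.
  - by apply: (mid i j); lia.
  - by apply: (mid i.+1 j.+1); lia.
have k1 : 1 < k.
  have := mid i.+1 j (i + k).+1 ltac:(lia) ltac:(lia) ci1 cj ltac:(lia).
  case: k ek => [|[|k]] ek; last by [].
    by move: cj; rewrite (_ : j = i.+1); lia.
  have := nXY i.+1 ltac:(lia); have := nXY i.+2 ltac:(lia).
  rewrite ci1 -[in c i.+3](_ : j = i.+3) ?cj; last by lia.
  rewrite addn1; lia.
(* If the midpoint r had color X, reflecting in it the other point of the
   double Y would give a neighbor of s of color X or Y. *)
have toY s : i.+1 < s -> s < j -> c s = X ->
    exists2 r, c r = Y & (s + j <= 2 * r <= s + j + 1) && (r < j).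
  move=> is1 sj cs.
  have [r er] : exists r, 2 * r = s + j \/ 2 * r = s + j.+1.
    exists ((s + j.+1)./2); lia.
  have sj1 : s <> j.-1.
    move=> e; have := nXY s ltac:(lia); rewrite cs (_ : s.+1 = j); [|lia]; lia.
  exists r; last by lia.
  have [//|rX] : c r = Y \/ c r = X.
    by case: er => er; [have := mid s j r|have := mid s j.+1 r]; lia.
  exfalso; case: er => er.
  - have cs1 : c s.-1 = X \/ c s.-1 = Y by have := ap (s.-1) r j.+1; lia.
    by apply: (noE s.-1) => //; rewrite ?prednK; lia.
  - have cs1 : c s.+1 = X \/ c s.+1 = Y by have := ap (s.+1) r j; lia.
    by apply: (noE s) => //; lia.
have toX r : i.+1 < r -> r < j -> c r = Y ->
    exists2 s, c s = X & (i + r <= 2 * s <= i + r + 1) && (i.+1 < s).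
  move=> ir rj cr.
  have [s es] : exists s, 2 * s = i + r \/ 2 * s = i.+1 + r.
    exists ((i.+1 + r)./2); lia.
  have ir2 : r <> i.+2.
    move=> e; have := nXY i.+1 ltac:(lia); rewrite ci1 -e cr; lia.
  exists s; last by lia.
  have [//|sY] : c s = X \/ c s = Y.
    by case: es => es; [have := mid i r s|have := mid i.+1 r s]; lia.
  exfalso; case: es => es.
  - have cs1 : c r.-1 = X \/ c r.-1 = Y by have := ap (i.+1) s r.-1; lia.
    by apply: (noE r.-1) => //; rewrite ?prednK; lia.
  - have cs1 : c r.+1 = X \/ c r.+1 = Y by have := ap i s r.+1; lia.
    by apply: (noE r) => //; lia.
have distinct d : (forall s s', i.+1 < s -> s' < j -> s' = s + d.+1 -> c s = X -> c s' = X -> False)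
   /\ (forall s s', i.+1 < s -> s' < j -> s' = s + d.+1 -> c s = Y -> c s' = Y -> False).
  elim/ltn_ind: d => -[|d] IHd.
    split=> s s' is1 sj; rewrite addn1 => es; subst s' => cs cs1.
      by apply: (noX s) => //; lia.
    by apply: (noY s) => //; lia.
  split=> s s' is1 sj es cs cs'.
  - have [r cr hr] := toY s is1 ltac:(lia) cs.
    have [r' cr' hr'] := toY s' ltac:(lia) sj cs'.
    have [_ /(_ r r')] := IHd (r' - r).-1 ltac:(lia).
    by apply=> //; lia.
  - have [r cr hr] := toX s is1 ltac:(lia) cs.
    have [r' cr' hr'] := toX s' ltac:(lia) sj cs'.
    have [/(_ r r') + _] := IHd (r' - r).-1 ltac:(lia).
    by apply=> //; lia.
have [cp|cp] := mid i.+1 j (i + k).+1 ltac:(lia) ltac:(lia) ci1 cj ltac:(lia).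
- have [r cr hr] := toY (i + k).+1 ltac:(lia) ltac:(lia) cp.
  have [s cs hs] := toX r ltac:(lia) ltac:(lia) cr.
  have [/(_ s (i + k).+1) + _] := distinct ((i + k).+1 - s).-1.
  by apply=> //; lia.
- have [s cs hs] := toX (i + k).+1 ltac:(lia) ltac:(lia) cp.
  have [r cr hr] := toY s ltac:(lia) ltac:(lia) cs.
  have [_ /(_ (i + k).+1 r)] := distinct (r - (i + k).+1).-1.
  by apply=> //; lia.
Qed.

(** * Colorings with a sparse color *)

Definition apart (c : nat -> nat) N d : Prop :=
  forall i, i + d <= N ->
    ~ (c i = 1 /\ c (i + d) = 2) /\ ~ (c i = 2 /\ c (i + d) = 1).

(** Color 0 is the dominant one, 1 the one that may occur twice in a row, and 2
the sparse one. Dominance is recorded only through [tri_apart]; isolation of the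
points of color 2 is the case of consecutive points in [tri_gap]. *)
Record tricoloring N g (c : nat -> nat) : Prop := Tricoloring {
  tri_ap : no_rainbow N c;
  tri_col : forall i, c i <= 2;
  tri_apart : apart c N 1;
  tri_gap : forall i j, i < j -> j <= N -> c i = 2 -> c j = 2 -> i + g <= j;
  tri_g : 1 < g
}.

Lemma tricoloring_shift N M x g c : x + N <= M ->
  tricoloring M g c -> tricoloring N g (fun i => c (x + i)).
Proof.
move=> NM [ap col bc gap g1]; split=> //.
- exact: no_rainbow_shift ap.
- by move=> i iN; have := bc (x + i) ltac:(lia); rewrite addnA.
- by move=> i j ij jN ci cj; have := gap (x + i) (x + j); lia.
Qed.

Lemma tricoloring_mirror N M g c : N <= M ->
  tricoloring M g c -> tricoloring N g (fun i => c (N - i)).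
Proof.
move=> NM [ap col bc gap g1]; split=> //.
- exact: no_rainbow_mirror ap.
- move=> i iN; have := bc (N - (i + 1)) ltac:(lia).
  by rewrite (_ : N - (i + 1) + 1 = N - i); [tauto|lia].
- by move=> i j ij jN ci cj; have := gap (N - j) (N - i); lia.
Qed.

(** The midpoint of points of colors 1 and 2 has one of these colors, and it is
at distance d from both. *)
Lemma apart_double N c d : no_rainbow N c -> (forall i, c i <= 2) ->
  apart c N d -> apart c N (2 * d).
Proof.
move=> ap col far i iN.
have := ap i (i + d) (i + 2 * d) ltac:(lia) ltac:(lia) ltac:(lia).
have := far i ltac:(lia); have := far (i + d) ltac:(lia).
rewrite -addnA addnn -mul2n; lia.
Qed.

Section Tricoloring.

Variables (N g : nat) (c : nat -> nat).
Hypotheses (tri : tricoloring N g c).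

Let ap := tri_ap tri.
Let col := tri_col tri.
Let gap := tri_gap tri.
Let g1 := tri_g tri.

Lemma apart_pow d : d \in [:: 1; 2; 4; 8] -> apart c N d.
Proof.
have a1 := tri_apart tri.
have a2 := apart_double ap col a1.
have a4 := apart_double ap col a2.
have a8 := apart_double ap col a4.
by rewrite !inE => /or4P[] /eqP ->.
Qed.

Lemma not_apart i j d : d \in [:: 1; 2; 4; 8] -> i <= N -> j <= N ->
  j = i + d \/ i = j + d -> c i = 1 -> c j = 2 -> False.
Proof.
move=> hd iN jN [e|e] ci cj; have := apart_pow hd; subst.
  by move=> /(_ i jN); lia.
by move=> /(_ j iN); lia.
Qed.

Lemma mid_neq0 i j k : i + k = 2 * j -> i <= N -> k <= N ->
  c i = 1 -> c k = 2 -> c j <> 0.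
Proof. by move=> e iN kN ci ck cj; case: (ap e iN kN) => [|[]]; congruence. Qed.

Lemma end_neq0 i j k : i + k = 2 * j -> i <= N -> k <= N ->
  c i = 1 -> c j = 2 -> c k <> 0.
Proof. by move=> e iN kN ci cj ck; case: (ap e iN kN) => [|[]]; congruence. Qed.

Lemma end_neq0' i j k : i + k = 2 * j -> i <= N -> k <= N ->
  c i = 2 -> c j = 1 -> c k <> 0.
Proof. by move=> e iN kN ci cj ck; case: (ap e iN kN) => [|[]]; congruence. Qed.

Lemma end_neq1 i j k : i + k = 2 * j -> i <= N -> k <= N ->
  c i = 0 -> c j = 2 -> c k <> 1.
Proof. by move=> e iN kN ci cj ck; case: (ap e iN kN) => [|[]]; congruence. Qed.

Lemma after2 i j : i < j < i + g -> j <= N -> c i = 2 -> c j <> 2.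
Proof. by case/andP=> ij ji jN ci cj; have := gap ij jN ci cj; lia. Qed.

Lemma before2 i j : j < i < j + g -> i <= N -> c i = 2 -> c j <> 2.
Proof. by case/andP=> ij ji jN ci cj; have := gap ij jN cj ci; lia. Qed.

Lemma is1 i : c i <> 0 -> c i <> 2 -> c i = 1.
Proof. by have := col i; case: (c i) => [|[|[]]]. Qed.

Lemma is2 i : c i <> 0 -> c i <> 1 -> c i = 2.
Proof. by have := col i; case: (c i) => [|[|[]]]. Qed.

Lemma is0 i : c i <> 1 -> c i <> 2 -> c i = 0.
Proof. by have := col i; case: (c i) => [|[|[]]]. Qed.

Lemma both1 i j d : d \in [:: 1; 2; 4; 8] -> 0 < d < g -> j = i + d ->
  j <= N -> c i <> 0 -> c j <> 0 -> c i = 1 /\ c j = 1.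
Proof.
move=> hd dg e jN ci cj.
have iN : i <= N by lia.
have n1 : c i = 1 -> c j <> 2.
  by move=> h1 h2; apply: (@not_apart i j d) => //; left.
have n2 : c j = 1 -> c i <> 2.
  by move=> h1 h2; apply: (@not_apart j i d) => //; right.
have cj1 : c j = 1.
  apply: is1 => // h; apply: (@after2 i j) => //; first by lia.
  by apply: is2 => // h1; apply: (n1 h1).
by split=> //; apply: is1 => //; apply: n2.
Qed.

Section RightHalf.

Hypotheses (gN : g <= N) (c0 : c 0 = 2) (cg : c g = 2).

Lemma window_neq2 j : 0 < j < g -> c j <> 2.
Proof. by move=> hj; apply: (@after2 0) => //; lia. Qed.

Lemma window_double j k : 0 < j < g -> 0 < k < g ->
  k = 2 * j \/ k + g = 2 * j -> c j = c k.
Proof.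
move=> hj hk hjk; have := window_neq2 hj; have := window_neq2 hk.
move=> ck cj; case: hjk => e.
  by have [|[]] := @ap 0 j k ltac:(lia) ltac:(lia) ltac:(lia); congruence.
by have [|[]] := @ap g j k ltac:(lia) ltac:(lia) ltac:(lia); congruence.
Qed.

Lemma window_ends : c 1 = 0 /\ c g.-1 = 0.
Proof.
split; apply: is0.
- by move=> h; apply: (@not_apart 1 0 1) => //; lia.
- by apply: window_neq2; lia.
- by move=> h; apply: (@not_apart g.-1 g 1) => //; lia.
- by apply: window_neq2; lia.
Qed.

(** This is the halving map used throughout: with g odd, every v has exactly one
such u, and with g even, the even v have two. *)
Lemma half_neq0 u v : v <= N -> 2 * u = v \/ 2 * u = v + g -> c v = 1 -> c u <> 0.
Proof.
move=> vN e cv; case: e => e.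
  by apply: (@mid_neq0 v u 0) => //; lia.
by apply: (@mid_neq0 v u g) => //; lia.
Qed.

(** Halving two points v, v' of color 1 at distance less than g cannot give
colors 2 at u and 1 at u'. With l the distance of u and u', the point w = u - l
has color 1 too, by reflection in u; doubling its distance from 0 or g gives a
point outside color 0, which reflection in u shows to be of color 2. So is then
its midpoint with v, at distance l < g from it. If 2 u = v + g and 2 l > g, then
v' itself is the reflection 2 (u - l) of 2 l in u. *)
Lemma halving_stays1 v v' u u' l : 2 * g <= v -> v <= N -> v' <= N ->
  c v = 1 -> c v' = 1 -> c u = 2 -> c u' = 1 ->
  2 * u = v \/ 2 * u = v + g -> 2 * u' = v' \/ 2 * u' = v' + g ->
  u' = u + l \/ u = u' + l -> 0 < l < g -> 2 * l <> g ->
  v < v' + g -> v' < v + g ->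
  (forall a t, a \in [:: l; 2 * l; g + l; g + 2 * l] -> a < 2 * g ->
     a + t = 2 * u -> t <= N -> c t <> 1) ->
  False.
Proof.
move=> gv vN v'N cv cv' cu cu' uv uv' ul lg l2g vv' v'v notB.
have gu : g <= u by lia.
have [w ew] : exists w, u = w + l by exists (u - l); lia.
have cw : c w = 1.
  case: ul => e; last by rewrite (_ : w = u') //; lia.
  apply: is1; last by apply: (@before2 u) => //; lia.
  by apply: (@end_neq0 u' u) => //; lia.
case: uv => uv.
- have c2w : c (2 * w) = 2.
    apply: is2; last by apply: (notB (2 * l)); rewrite ?inE ?eqxx ?orbT //; lia.
    by apply: (@end_neq0' 0 w) => //; lia.
  apply: (@after2 (2 * w) (2 * w + l)) => //; try lia.
  apply: is2; last by apply: (notB l); rewrite ?inE ?eqxx ?orbT //; lia.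
  by apply: (@mid_neq0 v _ (2 * w)) => //; lia.
- have [lg2|gl2] := ltnP (2 * l) g.
    have [t et] : exists t, t + g = 2 * w by exists (2 * w - g); lia.
    have ct : c t = 2.
      apply: is2; last by apply: (notB (g + 2 * l)); rewrite ?inE ?eqxx ?orbT //; lia.
      by apply: (@end_neq0' g w) => //; lia.
    apply: (@after2 t (t + l)) => //; try lia.
    apply: is2; last by apply: (notB (g + l)); rewrite ?inE ?eqxx ?orbT //; lia.
    by apply: (@mid_neq0 v _ t) => //; lia.
  by apply: (notB (2 * l) v') => //; rewrite ?inE ?eqxx ?orbT //; lia.
Qed.

Lemma double_of2_far v u : g < v -> v <= N -> 2 * u = v \/ 2 * u = v + g ->
  c u = 2 -> 2 * g <= v.
Proof.
move=> gv vN uv cu; rewrite leqNgt; apply/negP => v2.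
have eu : u <> g by lia.
case: (ltnP u g) => ug; first by apply: (@window_neq2 u) => //; lia.
by apply: (@after2 g u) => //; lia.
Qed.

(** * Odd gaps *)

Section OddGap.

Variable m : nat.
Hypotheses (g_odd : odd g) (mg : m %| g)
  (off_mult : forall j, 0 < j < g -> ~~ (m %| j) -> c j = 0).

Lemma off_mult2 a : 0 < a < 2 * g -> ~~ (m %| a) -> a <= N -> c a = 0.
Proof.
move=> ha ma aN; have [ag|ga] := ltnP a g; first by apply: off_mult; lia.
have ne : a <> g by move=> e; rewrite e mg in ma.
have mb : ~~ (m %| 2 * g - a) by rewrite dvdn_subr ?dvdn_mull //; lia.
have cb := @off_mult (2 * g - a) ltac:(clear -ha ga ne; lia) mb.
apply: is0; last by apply: (@after2 g) => //; clear -ha ga ne; lia.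
by apply: (@end_neq1 (2 * g - a) g) => //; clear -ha aN ga gN; lia.
Qed.

Lemma reflect_off_mult a u t : 2 * g <= N -> 0 < a < 2 * g -> ~~ (m %| a) ->
  a + t = 2 * u -> t <= N -> c u = 2 -> c t <> 1.
Proof.
move=> gN2 ha ma e tN cu.
have ca : c a = 0 by apply: off_mult2 => //; lia.
by apply: (@end_neq1 a u) => //; lia.
Qed.

(** Both points descend together under halving, and their difference never
becomes a multiple of m; but below 2 g color 1 occurs only at multiples of m. *)
Lemma no_near1 v v' d : v <= N -> v' <= N -> c v = 1 -> c v' = 1 ->
  v' = v + d \/ v = v' + d -> d < g -> ~~ (m %| d) -> False.
Proof.
have [K] := ubnP (maxn v v').
elim: K v v' d => // K IH v v' d vK vN v'N cv cv' vd dg md.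
have small w : w < 2 * g -> w <= N -> c w = 1 -> m %| w.
  move=> wg wN cw; apply: contraT => mw.
  have w0 : 0 < w by rewrite lt0n; apply: contraNneq mw => ->; rewrite dvdn0.
  by move: cw; rewrite (@off_mult2 w) // w0.
have vv' : 2 * g <= v \/ 2 * g <= v'.
  have [//|h] : (2 * g <= v \/ 2 * g <= v') \/ (v < 2 * g /\ v' < 2 * g) by lia.
  case: h => hv hv'; have mv := small v hv vN cv; have mv' := small v' hv' v'N cv'.
  case/negP: md; case: vd => e.
    by rewrite -(dvdn_addr d mv) -e.
  by rewrite -(dvdn_addr d mv') -e.
have half w : exists u, 2 * u = w \/ 2 * u = w + g.
  by clear -g_odd; exists (if odd w then (w + g)./2 else w./2); case: ifP; lia.
have [u uv] := half v; have [u' uv'] := half v'.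
have cu := half_neq0 vN uv cv; have cu' := half_neq0 v'N uv' cv'.
have [l ul] : exists l, u' = u + l \/ u = u' + l.
  by clear; case: (leqP u u') => ?; [exists (u' - u)|exists (u - u')]; lia.
have m2l : ~~ (m %| 2 * l).
  have [e|[e|e]] : 2 * l = d \/ g = d + 2 * l \/ 2 * l = g + d.
    by clear -uv uv' ul vd dg; lia.
  - by rewrite e.
  - by apply: contraNN md => h; rewrite -(dvdn_addl d h) -e.
  - by rewrite e dvdn_addr.
have l0 : 0 < l by case: l {ul} m2l => //; rewrite muln0 dvdn0.
have ml : ~~ (m %| l) by apply: contraNN m2l; apply: dvdn_mull.
have colu := col u; have colu' := col u'.
have gN2 : 2 * g <= N by clear -vv' vN v'N; lia.
have l2g : 2 * l <> g by move=> e; move: (g_odd); rewrite -e oddM.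
have notB w : w <= N -> c w = 2 -> forall a t,
    a \in [:: l; 2 * l; g + l; g + 2 * l] -> a < 2 * g -> a + t = 2 * w -> t <= N -> c t <> 1.
  move=> wN cw a t ha ag e tN; apply: (@reflect_off_mult a w) => //.
    by move: ha; rewrite !inE; clear -l0 g1 ag; lia.
  by move: ha; rewrite !inE => /or4P[] /eqP ->; rewrite ?(dvdn_addr _ mg).
have [[e e']|[[e e']|[[e e']|[e e']]]] :
    (c u = 1 /\ c u' = 1) \/ (c u = 2 /\ c u' = 1) \/ (c u = 1 /\ c u' = 2)
    \/ (c u = 2 /\ c u' = 2) by clear -cu cu' colu colu'; lia.
- by apply: (IH u u' l) => //; clear -g1 uv uv' ul vd dg vv' vK vN v'N; lia.
- have gv : 2 * g <= v.
    by apply: (@double_of2_far v u) => //; clear -vv' vd dg; lia.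
  by apply: (@halving_stays1 v v' u u' l) => //; try (apply: notB => //); clear -g1 gN uv uv' ul vd dg l0 vN v'N; lia.
- have gv : 2 * g <= v'.
    by apply: (@double_of2_far v' u') => //; clear -vv' vd dg; lia.
  by apply: (@halving_stays1 v' v u' u l) => //; try (apply: notB => //); clear -g1 gN uv uv' ul vd dg l0 vN v'N; lia.
- case: ul => ul.
    by apply: (@after2 u u') => //; clear -g1 gN uv uv' ul vd dg vN v'N vv' l0; lia.
  by apply: (@before2 u u') => //; clear -g1 gN uv uv' ul vd dg vN v'N vv' l0; lia.
Qed.

End OddGap.

(** * Even gaps *)

(** Doubling the distance of p from 0 gives u, and from g it gives u - g. *)
Lemma translate_down u p : ~~ odd g -> 2 * p = u -> u <= N -> g <= u ->
  c p = 1 -> c (u - g) <> 0.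
Proof.
by move=> g2 e uN gu cp; apply: (@end_neq0' g p) => //; lia.
Qed.

(** The halves of u and u + d both have color 1, so the pair can be translated
down by g until it reaches the window between 0 and g. The point g cannot be
strictly between u and u + d, because one of them would be at distance 2 or 4
from it. *)
Lemma no_even_pair d u : ~~ odd g -> d \in [:: 2; 4; 8] -> d <= g ->
  (forall w, ~~ odd w -> w + d < g -> c w = 1 -> c (w + d) = 1 -> False) ->
  ~~ odd u -> u + d <= N -> c u = 1 -> c (u + d) = 1 -> False.
Proof.
move=> g2 hd dg win; have dbl : d \in [:: 1; 2; 4; 8].
  by move: hd; rewrite !inE => /or3P[] ->; rewrite ?orbT.
have hbl : d./2 \in [:: 1; 2; 4; 8].
  by move: hd; rewrite !inE => /or3P[] /eqP ->.
have hd0 : 0 < d by move: hd; rewrite !inE => /or3P[] /eqP ->.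
have d2 : d = 2 * d./2 by move: hd; rewrite !inE => /or3P[] /eqP ->.
elim/ltn_ind: u => u IH u2 uN cu cud.
have ug : u <> g by move=> e; move: cu; rewrite e cg.
have [gu|ug'] := ltnP g u; last first.
  have [h|h] := ltnP (u + d) g; first by apply: (win u).
  have ne : u + d <> g by move=> e; move: cud; rewrite e cg.
  have e : exists2 e, e \in [:: 1; 2; 4; 8] & u + e = g \/ u + d = g + e.
    move: hd u2 g2 ug ug' h ne; rewrite !inE => /or3P[] /eqP -> *.
    - exfalso; lia.
    - by exists 2 => //; lia.
    - have [?|[?|?]] : u + 2 = g \/ u + 4 = g \/ u + 8 = g + 2 by lia.
      + by exists 2 => //; left.
      + by exists 4 => //; left.
      + by exists 2 => //; right.
  case: e => e he [hu|hu].
    by apply: (@not_apart u g e); lia.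
  by apply: (@not_apart (u + d) g e); lia.
have [p ep] : exists p, 2 * p = u by exists u./2; lia.
have cp := @half_neq0 p u ltac:(lia) ltac:(lia) cu.
have cpd := @half_neq0 (p + d./2) (u + d) ltac:(lia) ltac:(lia) cud.
have [cp1 cpd1] : c p = 1 /\ c (p + d./2) = 1.
  by apply: (@both1 p (p + d./2) _ hbl) => //; clear -ep uN dg d2 hd0; lia.
have q1 := @translate_down u p g2 ep ltac:(lia) ltac:(lia) cp1.
have q2 := @translate_down (u + d) (p + d./2) g2 ltac:(lia) ltac:(lia) ltac:(lia) cpd1.
have [v ev] : exists v, u = v + g by exists (u - g); clear -gu; lia.
have {}q1 : c v <> 0 by move: q1; rewrite ev addnK.
have {}q2 : c (v + d) <> 0.
  by move: q2; rewrite ev (_ : v + g + d - g = v + d) //; clear; lia.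
have vN : v <= N by clear -ev uN; lia.
have vdN : v + d <= N by clear -ev uN; lia.
have n1 : c v = 1 -> c (v + d) <> 2.
  by move=> h1 h2; apply: (@not_apart v (v + d) d) => //; left.
have n2 : c (v + d) = 1 -> c v <> 2.
  by move=> h1 h2; apply: (@not_apart (v + d) v d) => //; right.
have cvd : c (v + d) = 1.
  (* If d = g then v + d is u itself. *)
  have [dg'|edg] : d < g \/ d = g by clear -dg; lia.
    apply: is1 => // h; apply: (@after2 v (v + d)) => //.
      by clear -dg' hd0; lia.
    by apply: is2 => // h1; apply: (n1 h1).
  by rewrite edg -ev.
have cv : c v = 1 by apply: is1 => //; apply: n2.
apply: (IH v) => //; first by clear -ev g1; lia.
by move: u2; rewrite ev oddD (negbTE g2) addbF.
Qed.

Lemma halves1 u p e : ~~ odd g -> e \in [:: 1; 2; 4; 8] -> g = 2 * e ->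
  2 * p = u -> u <= N -> g <= u -> c u = 1 -> c p = 1 /\ c (p + e) = 1.
Proof.
move=> g2 he ge ep uN gu cu.
have cp := @half_neq0 p u ltac:(lia) ltac:(lia) cu.
have cpd := @half_neq0 (p + e) u ltac:(lia) ltac:(lia) cu.
by apply: (@both1 p (p + e) _ he) => //; clear -g1 ep uN ge gu; lia.
Qed.

(** For g = 2 the halves u/2 and u/2 + 1 have color 1 and one of them is even;
for g = 4 the point u - 4 has color 1. *)
Lemma no_even1 u : g = 2 \/ g = 4 -> ~~ odd u -> u <= N -> c u <> 1.
Proof.
move=> hg; have g2 : ~~ odd g by case: hg => ->.
elim/ltn_ind: u => u IH u2 uN cu.
have ug : u <> g by move=> e; move: cu; rewrite e cg.
have u0 : u <> 0 by move=> e; move: cu; rewrite e c0.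
have [gu|ug'] := ltnP g u; last first.
  have [w1 _] := window_ends.
  have [g4 e2] : g = 4 /\ u = 2 by lia.
  have : c 1 = c 2 by apply: window_double; rewrite ?g4 //; left.
  by rewrite -e2 cu w1.
have [p ep] : exists p, 2 * p = u by exists u./2; lia.
case: hg => hg.
- have [cp cp1] := @halves1 u p 1 g2 isT hg ep uN (ltnW gu) cu.
  have pN : p + 1 <= N by lia.
  case p2 : (odd p); last by apply: (IH p); rewrite ?p2 //; lia.
  by apply: (IH (p + 1)) => //; [lia|rewrite addn1 /= p2].
- have [cp cp1] := @halves1 u p 2 g2 isT hg ep uN (ltnW gu) cu.
  have t := @translate_down u p g2 ep uN (ltnW gu) cp.
  have cug : c (u - g) = 1.
    by apply: is1 => // h; apply: (@not_apart u (u - g) 4) => //; lia.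
  by apply: (IH (u - g)) => //; lia.
Qed.

(** * The exceptional gap 15 *)

Definition unit_res r := r \in [:: 1; 2; 4; 7; 8; 11; 13; 14].

(** Halving carries the pattern of the window to the right. A point q of color
2 off the multiples of 15 would have a point of color 1 at distance 1, 2, 4 or 8
on its left, whatever its residue. *)
Lemma full_window15 q : g = 15 -> c 3 = 1 -> c 5 = 1 -> q <= N ->
  ~~ (15 %| q) -> c q = if unit_res (q %% 15) then 0 else 1.
Proof.
move=> g15 c3 c5.
have step r : r < 15 -> unit_res ((2 * r) %% 15) = unit_res r.
  by do 15 (case: r => [|r] //).
have win j : 0 < j < 15 -> c j = if unit_res j then 0 else 1.
  have [w1 w14] := window_ends; rewrite g15 /= in w14.
  have E a b (h1 : 0 < a < 15) (h2 : 0 < b < 15)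
    (h3 : b = 2 * a \/ b + 15 = 2 * a) : c a = c b.
    by apply: window_double; rewrite g15.
  have e1 := E 1 2 isT isT ltac:(lia); have e2 := E 2 4 isT isT ltac:(lia).
  have e3 := E 4 8 isT isT ltac:(lia); have e4 := E 14 13 isT isT ltac:(lia).
  have e5 := E 13 11 isT isT ltac:(lia); have e6 := E 11 7 isT isT ltac:(lia).
  have e7 := E 3 6 isT isT ltac:(lia); have e8 := E 6 12 isT isT ltac:(lia).
  have e9 := E 12 9 isT isT ltac:(lia); have e10 := E 5 10 isT isT ltac:(lia).
  by case: j => [|[|[|[|[|[|[|[|[|[|[|[|[|[|[|j]]]]]]]]]]]]]]] // _;
    rewrite /unit_res /=; congruence.
elim/ltn_ind: q => q IH qN q15.
have [ql|qg] := ltnP q 15.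
  rewrite modn_small //; apply: win; case: q {IH qN} q15 ql => //.
have not2 : c q <> 2.
  move=> cq.
  have [d hd hB] : exists2 d, d \in [:: 1; 2; 4; 8] &
      ~~ (15 %| q - d) && ~~ unit_res ((q - d) %% 15).
    have [r [k [hr eq]]] : exists r k, r < 15 /\ q = 15 * k.+1 + r.
      exists (q %% 15), (q %/ 15).-1; lia.
    have hd d : d \in [:: 1; 2; 4; 8] -> (q - d) %% 15 = (15 + r - d) %% 15.
      move=> hd; rewrite eq (_ : 15 * k.+1 + r - d = 15 * k + (15 + r - d)).
        by rewrite mulnC modnMDl.
      by move: hd; rewrite !inE; lia.
    have r0 : 0 < r by move: q15; rewrite /dvdn eq mulnC modnMDl; case: r hr {eq hd}.
    suff [d h1 h2] : exists2 d, d \in [:: 1; 2; 4; 8] &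
        ((15 + r - d) %% 15 != 0) && ~~ unit_res ((15 + r - d) %% 15).
      by exists d => //; rewrite /dvdn hd.
    suff : has (fun d => ((15 + r - d) %% 15 != 0) && ~~ unit_res ((15 + r - d) %% 15)) [:: 1; 2; 4; 8].
      by move=> /hasP[d h1 h2]; exists d.
    by move: r hr r0 {eq hd}; do 15 (case=> [|] //).
  have d8 : 0 < d <= 8 by move: hd; rewrite !inE; lia.
  case/andP: hB => h15 hu.
  have := IH (q - d) ltac:(lia) ltac:(lia) h15; rewrite (negbTE hu) => cd.
  by apply: (@not_apart (q - d) q d); lia.
have [u hu] : exists u, 2 * u = q \/ 2 * u = q + g.
  by rewrite g15; exists (if odd q then (q + 15)./2 else q./2); case: ifP; lia.
have u15 : ~~ (15 %| u) by lia.
have cu := IH u ltac:(lia) ltac:(lia) u15.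
have -> : c q = c u.
  have cu2 : c u <> 2 by rewrite cu; case: ifP.
  case: hu => e.
    by case: (@ap 0 u q ltac:(lia) ltac:(lia) ltac:(lia)) => [|[]]; congruence.
  by case: (@ap g u q ltac:(lia) ltac:(lia) ltac:(lia)) => [|[]]; congruence.
rewrite cu -(step (u %% 15)) ?ltn_mod // modnMmr.
by congr (if unit_res _ then _ else _); lia.
Qed.

End RightHalf.

End Tricoloring.

(** Every 15 consecutive points contain 8 units mod 15. *)
Lemma unit_res_count n w :
  n <= 2 * count (fun i => unit_res ((i + w) %% 15)) (iota 0 n) + 3.
Proof.
have wm k v : count (fun i => unit_res ((i + v) %% 15)) (iota 0 k)
    = count (fun i => unit_res ((i + v %% 15) %% 15)) (iota 0 k).
  by apply: eq_count => i; rewrite modnDmr.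
elim/ltn_ind: n => n IH; have [n15|n15] := ltnP n 15.
  rewrite wm; have hr : w %% 15 < 15 by rewrite ltn_mod.
  set r := w %% 15 in hr *.
  have chk : all (fun k => all (fun v => k <= 2 * count (fun i => unit_res ((i + v) %% 15)) (iota 0 k) + 3) (iota 0 15)) (iota 0 15).
    by vm_compute.
  have := allP chk n; rewrite mem_iota => /(_ n15) /allP /(_ r).
  by rewrite mem_iota => /(_ hr).
have := IH (n - 15) ltac:(clear -n15; lia).
rewrite -[in iota 0 n](subnK n15) iotaD count_cat add0n -[X in iota X 15]addn0 iotaDl count_map.
set k := n - 15 => h.
have -> : count (preim (addn k) (fun i => unit_res ((i + w) %% 15))) (iota 0 15) = 8.
  rewrite (eq_count (a2 := fun i => unit_res ((i + (k + w) %% 15) %% 15))); last first.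
    by move=> i /=; rewrite modnDmr (addnC k) addnA.
  have : (k + w) %% 15 < 15 by rewrite ltn_mod.
  move: (_ %% _) => v hv.
  have chk : all (fun v => count (fun i => unit_res ((i + v) %% 15)) (iota 0 15) == 8) (iota 0 15) by vm_compute.
  by apply/eqP/(allP chk); rewrite mem_iota.
move: h; rewrite /k; move: n15; clear; lia.
Qed.

(** * The window between two points of color 2 *)

(** Doublings inside the window between 0 and g act as multiplication by 2 mod
g; this asks whether the orbits of j and of 1 or g - 1 meet before reaching 0.
Six steps are enough for g <= 16. *)
Definition joins_end g j :=
  has (fun i => has (fun k =>
    ((2 ^ i * j) %% g != 0) &&
    (((2 ^ i * j) %% g == (2 ^ k * 1) %% g) ||
     ((2 ^ i * j) %% g == (2 ^ k * g.-1) %% g))) (iota 0 6)) (iota 0 6).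

Lemma joins_end_even g j : 2 < g <= 16 -> ~~ odd g -> ~~ odd j -> 0 < j < g ->
  (g == 12) && (j == 6) || joins_end g j.
Proof.
move=> hg g2 j2 hj.
have chk : all (fun h => odd h || all (fun k => [|| odd k, (h == 12) && (k == 6) | joins_end h k])
    (iota 1 h.-1)) (iota 3 14) by vm_compute.
have := allP chk g; rewrite mem_iota (negbTE g2) /= => /(_ ltac:(lia)) /allP /(_ j).
by rewrite mem_iota (negbTE j2) /=; apply; lia.
Qed.

Definition window_modulus g m := (1 < m) && (m %| g) &&
  all (fun j => (m %| j) || joins_end g j) (iota 1 g.-1).

Lemma joins_end_odd g : 1 < g < 15 -> odd g -> exists2 m, 1 < m & (m %| g) /\
  forall j, 0 < j < g -> ~~ (m %| j) -> joins_end g j.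
Proof.
move=> hg g2.
have chk : all (fun h => ~~ odd h || has (window_modulus h) (iota 2 h)) (iota 2 13) by vm_compute.
have := allP chk g; rewrite mem_iota g2 /= => /(_ ltac:(lia)) /hasP[m _].
case/andP=> /andP[m1 mg] /allP h; exists m => //; split=> // j hj mj.
by have := h j; rewrite mem_iota (negbTE mj) /=; apply; lia.
Qed.

Lemma joins_end15 j : 0 < j < 15 -> ~~ (3 %| j) -> ~~ (5 %| j) -> joins_end 15 j.
Proof.
move=> hj j3 j5.
have chk : all (fun j => [|| 3 %| j, 5 %| j | joins_end 15 j]) (iota 1 14) by vm_compute.
by have := allP chk j; rewrite mem_iota (negbTE j3) (negbTE j5) /=; apply; lia.
Qed.

Section Window.

Variables (N g : nat) (c : nat -> nat).
Hypotheses (tri : tricoloring N g c) (gN : g <= N) (c0 : c 0 = 2) (cg : c g = 2).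

Lemma window_orbit i j : 0 < j < g -> (2 ^ i * j) %% g != 0 ->
  c ((2 ^ i * j) %% g) = c j.
Proof.
move=> hj; have g0 : 0 < g by lia.
elim: i => [|i IH]; first by rewrite mul1n modn_small //; lia.
rewrite expnS -mulnA -modnMmr; set t := (2 ^ i * j) %% g in IH * => nz.
have tg : t < g by rewrite ltn_mod.
have t0 : t != 0 by apply: contraNneq nz => ->; rewrite muln0 mod0n.
rewrite -IH //; symmetry; apply: (window_double tri gN c0 cg).
- by rewrite lt0n t0.
- by rewrite lt0n nz ltn_mod.
- have [h|h] := ltnP (2 * t) g; first by left; rewrite modn_small.
  right; have e : 2 * t = (2 * t - g) + g by lia.
  by rewrite [in LHS]e modnDr modn_small; lia.
Qed.

Lemma joins_end0 j : 0 < j < g -> joins_end g j -> c j = 0.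
Proof.
have g1 := tri_g tri; have [w1 wg] := window_ends tri gN c0 cg.
move=> hj /hasP[i _ /hasP[k _ /andP[nz /orP[] /eqP e]]].
  by rewrite -(window_orbit hj nz) e window_orbit -?e //; lia.
by rewrite -(window_orbit hj nz) e window_orbit -?e //; lia.
Qed.

(** For g = 12, doubling 6 leads out of the window, to its end 12. *)
Lemma even_window j : 2 < g <= 16 -> ~~ odd g -> ~~ odd j -> 0 < j < g ->
  (g = 12 /\ j = 6) \/ c j = 0.
Proof.
move=> hg g2 j2 hj; have [?|ne] := EM (g = 12 /\ j = 6); [by left|right].
apply: joins_end0 => //; have := joins_end_even hg g2 j2 hj.
by case/orP=> // /andP[/eqP ? /eqP ?]; case: ne.
Qed.

Lemma even_window_pair d w : 2 < g <= 16 -> ~~ odd g -> ~~ odd w -> ~~ odd d ->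
  0 < d -> w + d < g -> c w = 1 -> c (w + d) = 1 -> False.
Proof.
move=> hg g2 w2 d2 d0 wd cw cwd.
have w0 : 0 < w by case: w cw {w2 wd cwd} => //; rewrite c0.
have [[_ e]|] := even_window hg g2 w2 ltac:(lia); last by rewrite cw.
have [[_ e']|] := @even_window (w + d) hg g2 ltac:(lia) ltac:(lia); last by rewrite cwd.
lia.
Qed.

Lemma odd_window : 1 < g <= 16 -> odd g ->
  (exists m, [/\ 1 < m, m %| g & forall j, 0 < j < g -> ~~ (m %| j) -> c j = 0])
  \/ [/\ g = 15, c 3 = 1 & c 5 = 1].
Proof.
move=> hg g2; have [g15|ge15] := ltnP g 15.
  have [m m1 [mg h]] := @joins_end_odd g ltac:(lia) g2; left; exists m; split=> //.
  by move=> j hj mj; apply: joins_end0 (h j hj mj).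
have g15 : g = 15 by move: g2; have [->|->] : g = 15 \/ g = 16 by lia.
have orb i j (hj : 0 < j < 15) (nz : (2 ^ i * j) %% 15 != 0) : c ((2 ^ i * j) %% 15) = c j.
  by have := @window_orbit i j; rewrite g15; apply.
have n2 j : 0 < j < 15 -> c j <> 2.
  by move=> hj; apply: (window_neq2 tri gN c0 cg); rewrite ?g15.
have unitA j : 0 < j < 15 -> ~~ (3 %| j) -> ~~ (5 %| j) -> c j = 0.
  by move=> hj j3 j5; apply: joins_end0; rewrite g15 //; apply: joins_end15.
have [c3|c3] := eqVneq (c 3) 0.
  left; exists 5; rewrite g15; split=> // j hj j5.
  have [j3|] := boolP (3 %| j); last by move=> j3; apply: unitA.
  have [-> //|[->|[->|->]]] : j = 3 \/ j = 6 \/ j = 12 \/ j = 9 by lia.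
  - by have := orb 1 3 isT isT; rewrite c3.
  - by have := orb 2 3 isT isT; rewrite c3.
  - by have := orb 3 3 isT isT; rewrite c3.
have [c5|c5] := eqVneq (c 5) 0.
  left; exists 3; rewrite g15; split=> // j hj j3.
  have [j5|] := boolP (5 %| j); last by move=> j5; apply: unitA.
  have [-> //|->] : j = 5 \/ j = 10 by lia.
  by have := orb 1 5 isT isT; rewrite c5.
by right; split=> //; apply: (is1 tri); [apply/eqP|apply: n2|apply/eqP|apply: n2].
Qed.

End Window.

(** * Both sides of a closest pair *)

(** The right and the left part are handled by the same lemmas, with x and
x + g as the origin respectively. *)
Section Pair.

Variables (N g : nat) (c : nat -> nat) (x : nat).
Hypotheses (tri : tricoloring N g c) (xN : x + g <= N) (cx : c x = 2)
  (cxg : c (x + g) = 2) (g16 : g <= 16).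

Let y := x + g.
Let cR i := c (x + i).
Let cL i := c (y - i).

Lemma triR : tricoloring (N - x) g cR.
Proof. by apply: tricoloring_shift tri; lia. Qed.

Lemma triL : tricoloring y g cL.
Proof. exact: tricoloring_mirror tri. Qed.

Lemma gapR : g <= N - x. Proof. lia. Qed.
Lemma gapL : g <= y. Proof. exact: leq_addl. Qed.
Lemma cR0 : cR 0 = 2. Proof. by rewrite /cR addn0. Qed.
Lemma cL0 : cL 0 = 2. Proof. by rewrite /cL subn0. Qed.
Lemma cLg : cL g = 2. Proof. by rewrite /cL addnK. Qed.

Let g1 := tri_g tri.

(** As 14 x is - x mod 15, the residue is that of i - x, and units mod 15 are
stable under the change of sign needed on the left of x. *)
Lemma full_gap0 i : g = 15 -> cR 3 = 1 -> cR 5 = 1 -> i <= N ->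
  unit_res ((i + 14 * x) %% 15) -> c i = 0.
Proof.
move=> g15 c3 c5 iN hi.
have [xi|ix] := leqP x i.
  have e : (i + 14 * x) %% 15 = (i - x) %% 15.
    by rewrite (_ : i + 14 * x = x * 15 + (i - x)) ?modnMDl //; lia.
  rewrite e in hi.
  have h15 : ~~ (15 %| i - x) by rewrite /dvdn; apply: contraTneq hi => ->.
  have := @full_window15 _ _ _ triR gapR cR0 cxg (i - x) g15 c3 c5 ltac:(lia) h15.
  by rewrite hi /cR subnKC.
have f q := @full_window15 _ _ _ triR gapR cR0 cxg q g15 c3 c5.
have l3 : cL 3 = 1.
  have := f 12 ltac:(lia) isT; rewrite /cL /cR /y (_ : x + g - 3 = x + 12) //; lia.
have l5 : cL 5 = 1.
  have := f 10 ltac:(lia) isT; rewrite /cL /cR /y (_ : x + g - 5 = x + 10) //; lia.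
set q := y - i; have eq : (q %% 15) + ((i + 14 * x) %% 15) = 15 \/ q %% 15 = 0 /\ (i + 14 * x) %% 15 = 0.
  by rewrite /q /y; lia.
have uq : unit_res (q %% 15).
  have r15 : (i + 14 * x) %% 15 < 15 by rewrite ltn_mod.
  move: hi; case: eq => [e|[_ ->] //].
  have -> : q %% 15 = 15 - (i + 14 * x) %% 15 by lia.
  by move: (_ %% 15) r15; do 15 (case=> [|] //).
have h15 : ~~ (15 %| q) by rewrite /dvdn; apply: contraTneq uq => ->.
have := @full_window15 _ _ _ triL gapL cL0 cLg q g15 l3 l5 ltac:(rewrite /q /y; lia) h15.
by rewrite uq /cL /q subKn // /y; lia.
Qed.

Section EvenGap.

Hypothesis (g2 : ~~ odd g).

Lemma no_pair d u : 2 < g -> d \in [:: 2; 4; 8] -> d <= g -> ~~ odd (u + x) ->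
  u + d <= N -> c u = 1 -> c (u + d) = 1 -> False.
Proof.
move=> hg hd dg u2 uN cu cud.
have hg' : 2 < g <= 16 by rewrite hg.
have [d2 d0] : ~~ odd d /\ 0 < d by move: hd; rewrite !inE => /or3P[] /eqP ->.
have [xu|ux] := leqP x u.
  apply: (@no_even_pair _ _ _ triR gapR cR0 cxg d (u - x)) => //.
  - by move=> w w2; apply: (even_window_pair triR gapR cR0 cxg).
  - by rewrite oddB // -oddD.
  - by clear -uN xu; lia.
  - by rewrite /cR subnKC.
  - by rewrite /cR addnA subnKC.
have e : y - (u + d) + d = y - u by rewrite /y; clear -ux dg; lia.
apply: (@no_even_pair _ _ _ triL gapL cL0 cLg d (y - (u + d))) => //.
- by move=> w w2; apply: (even_window_pair triL gapL cL0 cLg).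
- rewrite oddB; last by rewrite /y; clear -ux dg; lia.
  by rewrite /y !oddD (negbTE g2) (negbTE d2) !addbF -oddD addnC.
- by rewrite e leq_subr.
- by rewrite /cL subKn // /y; clear -ux dg; lia.
- by rewrite e /cL subKn // /y; clear -ux dg; lia.
Qed.

Lemma no_pair_neq0 d u : 2 < g -> d \in [:: 2; 4; 8] -> d < g -> ~~ odd (u + x) ->
  u + d <= N -> c u <> 0 -> c (u + d) <> 0 -> False.
Proof.
move=> hg hd dg u2 uN cu cud.
have d0 : 0 < d by move: hd; rewrite !inE => /or3P[] /eqP ->.
have [cu1 cud1] : c u = 1 /\ c (u + d) = 1.
  apply: (both1 tri (d := d)) => //; last by rewrite d0.
  by move: hd; rewrite !inE orbC => ->; rewrite ?orbT.
exact: (no_pair hg hd (ltnW dg)) u2 uN cu1 cud1.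
Qed.

Variable b : nat.
Hypotheses (bN : b < N) (cb : c b = 1) (cb1 : c b.+1 = 1).

(** One of b and b + 1 is at even distance from x. *)
Lemma even_gap_gt4 : 4 < g.
Proof.
have [h|//] := leqP g 4; exfalso.
have hg : g = 2 \/ g = 4 by move: g2; clear -h g1; lia.
have key u : ~~ odd (u + x) -> u <= N -> c u <> 1.
  move=> u2 uN; have [xu|ux] := leqP x u.
    have := @no_even1 _ _ _ triR gapR cR0 cxg (u - x) hg.
    by rewrite oddB // -oddD /cR subnKC //; apply=> //; clear -uN xu; lia.
  have uy : u <= y by rewrite /y; clear -ux; lia.
  have := @no_even1 _ _ _ triL gapL cL0 cLg (y - u) hg.
  rewrite oddB // /cL subKn //; apply; last by rewrite leq_subr.
  by rewrite /y oddD (negbTE g2) addbF -oddD addnC.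
case b2 : (odd (b + x)).
  by apply: (key b.+1) => //=; rewrite b2.
by apply: (key b) => //; [rewrite b2|apply: ltnW].
Qed.

Lemma refl_neq0 z q e : z + e = 2 * q -> z <= N -> e <= N -> c z = 2 -> c q = 1 -> c e <> 0.
Proof. by move=> h zN eN cz cq; apply: (@end_neq0' _ _ _ tri z q e). Qed.

(** The reflections 2 q - x and 2 (q + 2) - x of x are outside color 0, at
distance 4 from each other and at even distance from x. *)
Lemma no_odd_pair2 q : odd (q + x) -> x <= 2 * q -> 2 * (q + 2) <= N + x ->
  c q <> 0 -> c (q + 2) <> 0 -> False.
Proof.
move=> q2 xq qN cq cq'; have g4 := even_gap_gt4.
have [cq1 cq1'] : c q = 1 /\ c (q + 2) = 1.
  by apply: (both1 tri (d := 2)) => //; clear -g4 qN xN; lia.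
have [e he] : exists e, x + e = 2 * q by exists (2 * q - x); clear -xq; lia.
have ce := @refl_neq0 x q e he ltac:(clear -xN; lia) ltac:(clear -he qN; lia) cx cq1.
have ce' := @refl_neq0 x (q + 2) (e + 4) ltac:(clear -he; lia) ltac:(clear -xN; lia)
  ltac:(clear -he qN; lia) cx cq1'.
apply: (@no_pair_neq0 4 e) => //; clear -he qN g4; lia.
Qed.

(** Reflecting x and x + g in q and q + 4 gives four points outside color 0 at
even distance from x, two of them at distance 8, or 2 when g = 6. This leaves
g = 8 with two points of color 2 at distance 8 from each other, at a distance
from x that is 2 mod 4. An even point b0 of color 1 has midpoints of color 1
with x and x + 8, and with these two points; one of the two pairs of midpoints is
at even distance from x and has points at distance 4. *)
Lemma no_odd_pair4 q : odd (q + x) -> y <= 2 * q -> 2 * (q + 4) <= N + x ->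
  c q <> 0 -> c (q + 4) <> 0 -> False.
Proof.
move=> q2 yq qN cq cq'; have g4 := even_gap_gt4; have yN : y <= N by [].
have [cq1 cq1'] : c q = 1 /\ c (q + 4) = 1.
  by apply: (both1 tri (d := 4)) => //; clear -g4 qN xN; lia.
have [e [he heg]] : exists e, x + (e + g) = 2 * q /\ y + e = 2 * q.
  by exists (2 * q - y); rewrite /y in yq *; clear -yq; lia.
have ce := @refl_neq0 x q (e + g) he ltac:(clear -xN; lia) ltac:(clear -he qN; lia) cx cq1.
have ce' := @refl_neq0 x (q + 4) (e + g + 8) ltac:(clear -he; lia) ltac:(clear -xN; lia)
  ltac:(clear -he qN; lia) cx cq1'.
have cf := @refl_neq0 y q e heg yN ltac:(clear -he qN; lia) cxg cq1.
have cf' := @refl_neq0 y (q + 4) (e + 8) ltac:(clear -heg; lia) yN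
  ltac:(clear -he qN g1; lia) cxg cq1'.
have eg2 : ~~ odd (e + g + x) by move: g2; clear -he; lia.
have eN : e + g + 8 <= N by clear -he qN; lia.
have [g8|[g6|ge8]] : 8 < g \/ g = 6 \/ g = 8 by move: g2; clear -g4; lia.
- by apply: (@no_pair_neq0 8 (e + g)) => //; clear -g4; lia.
- apply: (@no_pair_neq0 2 (e + g)) => //; try (clear -g4 eN; lia).
  by rewrite -addnA (_ : g + 2 = 8) // g6.
have [ceC ceC'] : c (e + g) = 2 /\ c (e + g + 8) = 2.
  have nB : ~ (c (e + g) = 1 /\ c (e + g + 8) = 1).
    move=> [h1 h2]; apply: (@no_pair 8 (e + g)) => //; try (clear -g4 ge8; lia).
  have n1 : ~ (c (e + g) = 1 /\ c (e + g + 8) = 2).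
    by move=> [h1 h2]; apply: (@not_apart _ _ _ tri (e + g) (e + g + 8) 8) => //;
      [clear -eN; lia|left].
  have n2 : ~ (c (e + g + 8) = 1 /\ c (e + g) = 2).
    by move=> [h1 h2]; apply: (@not_apart _ _ _ tri (e + g + 8) (e + g) 8) => //;
      [clear -eN; lia|right].
  have := tri_col tri (e + g); have := tri_col tri (e + g + 8).
  by move: ce ce' nB n1 n2; clear; lia.
have [b0 [b02 b0N cb0]] : exists b0, [/\ ~~ odd (b0 + x), b0 <= N & c b0 = 1].
  case b2 : (odd (b + x)); first by exists b.+1; rewrite /= b2.
  by exists b; rewrite b2 ltnW.
have quad z : z + 8 <= N -> ~~ odd (b0 + z) -> c z = 2 -> c (z + 8) = 2 ->
    exists p, [/\ 2 * p = b0 + z, p + 4 <= N, c p = 1 & c (p + 4) = 1].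
  move=> zN bz cz cz8; have [p hp] : exists p, 2 * p = b0 + z.
    by exists (b0 + z)./2; clear -bz; lia.
  have pN : p + 4 <= N by clear -hp zN b0N; lia.
  have cp : c p <> 0.
    by apply: (@mid_neq0 _ _ _ tri b0 p z) => //; clear -zN hp; lia.
  have cp4 : c (p + 4) <> 0.
    by apply: (@mid_neq0 _ _ _ tri b0 (p + 4) (z + 8)) => //; clear -zN hp; lia.
  have [? ?] : c p = 1 /\ c (p + 4) = 1.
    by apply: (both1 tri (d := 4)) => //; clear -ge8; lia.
  by exists p.
have [p [hp pN cp cp4]] := quad x ltac:(clear -xN ge8; lia) b02 cx ltac:(by rewrite -ge8).
have [p' [hp' pN' cp' cp4']] := quad (e + g) eN ltac:(clear -b02 eg2; lia) ceC ceC'.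
case px : (odd (p + x)).
  by apply: (@no_pair 4 p') => //; clear -hp hp' he q2 px ge8; lia.
by apply: (@no_pair 4 p) => //; [clear -ge8; lia|clear -ge8; lia|rewrite px].
Qed.

(** Two progressions of difference 2 are used: all points a + 2 j at even
distance from x, and the points q + 2 j at odd distance from x for which the
reflections of [no_odd_pair4] stay in the interval. In each of them, at least
two points out of three have color 0. *)
Lemma even_gap_count :
  3 * N.+1 <= 6 * count (fun i => c i == 0) (iota 0 N.+1) + 29.
Proof.
have g4 := even_gap_gt4.
pose a := nat_of_bool (odd x); pose m1 := (N + 2 - a)./2.
have [q hq] : exists q, odd (q + x) /\ x + g <= 2 * q <= x + g + 3.
  by exists (uphalf (x + g) + ~~ odd (uphalf (x + g) + x)); clear; lia.
pose m2 := ((N + x)./2 + 2 - q)./2.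
have b1 j : j < m1 -> a + 2 * j <= N by rewrite /m1 /a; clear; lia.
have b2 j : j < m2 -> 2 * (q + 2 * j) <= N + x by rewrite /m2; clear; lia.
have aq : odd (a + q) by rewrite /a; case: hq; clear; lia.
have h := @count_two_progressions (fun i => c i == 0) N a m1 q m2 aq b1
  (fun j hj => ltac:(have := b2 j hj; clear -xN; lia)).
have s1 : 3 * count (fun j => ~~ (c (a + 2 * j) == 0)) (iota 0 m1) <= m1 + 2.
  apply: (@count_spaced 3) => // i j ij jm /eqP ci /eqP cj.
  rewrite leqNgt; apply/negP => lt.
  have [e|e] : a + 2 * j = a + 2 * i + 2 \/ a + 2 * j = a + 2 * i + 4 by clear -ij lt; lia.
  - apply: (no_pair_neq0 (d := 2) (u := a + 2 * i)); rewrite -?e //.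
    + by clear -g4; lia.
    + by clear -g4; lia.
    + by rewrite /a; clear; lia.
    + exact: b1.
  - apply: (no_pair_neq0 (d := 4) (u := a + 2 * i)); rewrite -?e //.
    + by clear -g4; lia.
    + by rewrite /a; clear; lia.
    + exact: b1.
have s2 : 3 * count (fun j => ~~ (c (q + 2 * j) == 0)) (iota 0 m2) <= m2 + 2.
  apply: (@count_spaced 3) => // i j ij jm /eqP ci /eqP cj.
  rewrite leqNgt; apply/negP => lt; have bj := b2 j jm.
  case: hq => q2 hq.
  have [e|e] : q + 2 * j = q + 2 * i + 2 \/ q + 2 * j = q + 2 * i + 4 by clear -ij lt; lia.
  - apply: (no_odd_pair2 (q := q + 2 * i)); rewrite -?e //.
    + by move: q2; clear; lia.
    + by clear -hq; lia.
  - apply: (no_odd_pair4 (q := q + 2 * i)); rewrite -?e //.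
    + by move: q2; clear; lia.
    + by clear -hq; lia.
have n1 := count_neg (fun j => c (a + 2 * j) == 0) m1.
have n2 := count_neg (fun j => c (q + 2 * j) == 0) m2.
have e1 : 2 * m1 >= N by rewrite /m1 /a; clear; lia.
have e2 : 4 * m2 + g + 2 >= N by case: hq => _ hq; rewrite /m2; clear -hq; lia.
move: h s1 s2 n1 n2 e1 e2; clear -g16; simpl; lia.
Qed.

End EvenGap.

Section Doubled.

Variable b : nat.
Hypotheses (bN : b < N) (cb : c b = 1) (cb1 : c b.+1 = 1).

(** A double of color 1 lies on the right of x or on the left of x + g; the
window seen from either side must then be the exceptional one. *)
Lemma odd_gap : odd g -> [/\ g = 15, cR 3 = 1 & cR 5 = 1].
Proof.
move=> g2.
have hg16 : 1 < g <= 16 by rewrite g1.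
have no1 m d : 1 < m -> d = 1 -> ~~ (m %| d) by move=> m1 ->; rewrite dvdn1; lia.
have noR : (exists m, [/\ 1 < m, m %| g & forall j, 0 < j < g -> ~~ (m %| j) -> cR j = 0]) ->
    b < x.
  case=> m [m1 mg h]; rewrite ltnNge; apply/negP => xb.
  apply: (@no_near1 _ _ _ triR gapR cR0 cxg m g2 mg h (b - x) (b.+1 - x) 1) => //.
  - lia.
  - lia.
  - by rewrite /cR subnKC.
  - by rewrite /cR subnKC //; lia.
  - by left; lia.
  - exact: no1.
have noL : (exists m, [/\ 1 < m, m %| g & forall j, 0 < j < g -> ~~ (m %| j) -> cL j = 0]) ->
    y <= b.
  case=> m [m1 mg h]; rewrite leqNgt; apply/negP => yb.
  apply: (@no_near1 _ _ _ triL gapL cL0 cLg m g2 mg h (y - b.+1) (y - b) 1) => //.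
  - lia.
  - lia.
  - by rewrite /cL subKn.
  - by rewrite /cL subKn //; lia.
  - by left; lia.
  - exact: no1.
have [/noR hR|//] := odd_window triR gapR cR0 cxg hg16 g2.
have [/noL hL|[g15 c3 c5]] := odd_window triL gapL cL0 cLg hg16 g2.
  by exfalso; move: hL; rewrite /y; lia.
have f q := @full_window15 _ _ _ triL gapL cL0 cLg q g15 c3 c5.
have f12 := f 12 ltac:(rewrite /y; lia) isT.
have f10 := f 10 ltac:(rewrite /y; lia) isT.
split=> //.
  by move: f12; rewrite /cL /cR /y (_ : x + g - 12 = x + 3) //; lia.
by move: f10; rewrite /cL /cR /y (_ : x + g - 10 = x + 5) //; lia.
Qed.

Lemma tight_gap_count :
  3 * N.+1 <= 6 * count (fun i => c i == 0) (iota 0 N.+1) + 29.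
Proof.
case g2 : (odd g); last by apply: (even_gap_count _ bN cb cb1); rewrite g2.
have [g15 c3 c5] := odd_gap g2.
have le : count (fun i => unit_res ((i + 14 * x) %% 15)) (iota 0 N.+1) <=
    count (fun i => c i == 0) (iota 0 N.+1).
  rewrite -[leqLHS]size_filter -size_filter; apply: uniq_leq_size.
    by rewrite filter_uniq ?iota_uniq.
  move=> i; rewrite !mem_filter mem_iota ltnS => /andP[hi iN]; rewrite iN andbT.
  by apply/eqP/(full_gap0 g15 c3 c5).
by have := unit_res_count N.+1 (14 * x); move: le; clear; lia.
Qed.

End Doubled.

End Pair.

(** * A large color class *)

(** The two alternatives are the two ways to find a large class: the sparse
color has few points, or one color takes nearly half of the interval. *)
Theorem large_class N c L : no_rainbow N c ->
  (forall v, count (fun i => c i == v) (iota 0 N.+1) <= L) ->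
  8 * N <= 17 * L \/ 3 * N.+1 <= 6 * L + 29.
Proof.
move=> ap hL; have [[A dom]|[P [Q hPQ]]] := dominant_or_two_colors ap; last first.
  right; have h := @count_interval_but4 (fun i => (c i == P) || (c i == Q)) N.
  have {h} := h (fun i i1 iN => ltac:(case: (hPQ i i1 iN) => ->; rewrite eqxx ?orbT //)).
  have : count (fun i => (c i == P) || (c i == Q)) (iota 0 N.+1) <= L + L.
    apply: leq_trans (leq_add (hL P) (hL Q)).
    by rewrite -count_predUI leq_addr.
  by clear; lia.
have [[B [BA [b [bN [cb cb1]]]]]|nd] := EM (exists B, B <> A /\ exists b, b < N /\ c b = B /\ c b.+1 = B); last first.
  right.
  have iso : 2 * count (fun i => c i != A) (iota 0 N.+1) <= N.+1 + 1.
    apply: (@count_spaced 2) => // i j ij jN /eqP ci /eqP cj.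
    rewrite leqNgt; apply/negP => lt; have e : j = i.+1 by lia.
    subst j; apply: nd; exists (c i); split=> //; exists i; split; first by lia.
    by split=> //; have := dom i ltac:(lia); case=> [->|[]].
  by have := count_neg (fun i => c i == A) N.+1; have := hL A; move: iso; clear; simpl; lia.
pose d i := if c i == A then 0 else if c i == B then 1 else 2.
have d0 i : d i = 0 -> c i = A by rewrite /d; case: eqP => //; case: eqP.
have d1 i : d i = 1 -> c i = B by rewrite /d; case: eqP => //; case: eqP.
have d2 i : d i = 2 -> c i <> A /\ c i <> B by rewrite /d; do 2 case: eqP => //.
have dA i : d i <> 0 -> c i <> A by rewrite /d; case: eqP.
have edge i : i < N -> c i <> A -> c i.+1 <> A -> c i = c i.+1.
  by move=> iN n1 n2; have := dom i ltac:(lia); case=> [//|[]].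
have apd : no_rainbow N d.
  by move=> i j k e iN kN; rewrite /d; case: (ap i j k e iN kN) => [->|[->|->]]; tauto.
have ad : apart d N 1.
  move=> i; rewrite addn1 => iN; split=> -[h1 h2].
    have [n1 n2] := d2 _ h2; have := d1 _ h1; have := edge i iN; rewrite (d1 _ h1) => h.
    by case: n2; rewrite -h.
  have [n1 n2] := d2 _ h1; have := edge i iN; rewrite (d1 _ h2) => h.
  by case: n2; rewrite -h.
have nCC i : i < N -> d i = 2 -> d i.+1 = 2 -> False.
  move=> iN h1 h2; have [n1 n2] := d2 _ h1; have [n1' n2'] := d2 _ h2.
  have e := edge i iN n1 n1'.
  have ne : B <> c i by move=> h; apply: n2.
  have nXY k : k < N -> ~ (c k = B /\ c k.+1 = c i) /\ ~ (c k = c i /\ c k.+1 = B).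
    by move=> kN; split=> -[h3 h4]; have := edge k kN; rewrite h3 h4 => h; apply: ne;
      [|symmetry]; apply: h.
  have nYX k : k < N -> ~ (c k = c i /\ c k.+1 = B) /\ ~ (c k = B /\ c k.+1 = c i).
    by move=> /nXY[].
  have [bi|ib|bi] := ltngtP b i.
  - exact: (one_doubled_color ap nXY ne bi iN cb cb1 erefl (esym e)).
  - exact: (one_doubled_color ap nYX (nesym ne) ib bN erefl (esym e) cb cb1).
  - by apply: ne; rewrite -bi.
have [small|big] := leqP (17 * count (fun i => d i == 2) (iota 0 N.+1)) (N + 17).
  left; have e3 : count (fun i => c i == A) (iota 0 N.+1) + count (fun i => c i == B) (iota 0 N.+1)
      + count (fun i => d i == 2) (iota 0 N.+1) = N.+1.
    rewrite count_three ?size_iota // => i; rewrite /d.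
    by case: eqP => [->|_]; [rewrite (_ : A == B = false) //; apply/eqP; exact: nesym|case: eqP].
  by have := hL A; have := hL B; move: e3 small; clear; lia.
right.
have exg : exists g, `[< exists x, [/\ 0 < g, x + g <= N, d x = 2 & d (x + g) = 2] >].
  apply: contrapT => ng; move: big; rewrite ltnNge => /negP; apply.
  have := @count_spaced 17 (fun i => d i == 2) N.+1 isT.
  rewrite addSn addnS => h; apply: leq_trans (h _) _; last by clear; lia.
  move=> i j ij jN /eqP di /eqP dj; exfalso; apply: ng; exists (j - i); apply/asboolP.
  by exists i; rewrite subnKC ?(ltnW ij) // subn_gt0.
have [g /asboolP[x [g0 xN dx dxg]] gmin] := ex_minnP exg.
have gap i j : i < j -> j <= N -> d i = 2 -> d j = 2 -> i + g <= j.
  move=> ij jN di dj; rewrite -leq_subRL ?(ltnW ij) //; apply: gmin; apply/asboolP.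
  by exists i; rewrite subnKC ?(ltnW ij) // subn_gt0.
have g1 : 1 < g.
  rewrite ltnNge; apply/negP => gl; have e : g = 1 by lia.
  by move: dxg xN; rewrite e addn1 => dx1 xN; apply: (nCC x).
have g16 : g <= 16.
  rewrite leqNgt; apply/negP => g17; move: big; rewrite ltnNge => /negP; apply.
  have := @count_spaced 17 (fun i => d i == 2) N.+1 isT.
  move=> h; apply: leq_trans (h _) _; last by clear; lia.
  by move=> i j ij jN /eqP di /eqP dj; have := gap i j ij jN di dj; lia.
have tri : tricoloring N g d.
  by split=> // i; rewrite /d; case: eqP => // _; case: eqP.
have dB i : c i = B -> d i = 1 by rewrite /d => ->; rewrite eqxx; case: eqP.
have t := tight_gap_count tri xN dx dxg g16 bN (dB _ cb) (dB _ cb1).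
have eA : count (fun i => d i == 0) (iota 0 N.+1) = count (fun i => c i == A) (iota 0 N.+1).
  by apply: eq_count => i; rewrite /= /d; case: (c i == A) => //; case: (c i == B).
by rewrite eA in t; have := hL A; move: t; clear; lia.
Qed.

(** * The bounds for f *)

Lemma rainbow_free_no_rainbow N c : rainbow_free N.+1 c -> no_rainbow N (fun i => c i.+1).
Proof.
move=> rf; have key i j k : i < j -> i + k = 2 * j -> k <= N ->
    c i.+1 = c j.+1 \/ c j.+1 = c k.+1 \/ c i.+1 = c k.+1.
  move=> ij e kN; apply: contrapT => h; apply: rf; exists i.+1, (j - i).
  have -> : i.+1 + (j - i) = j.+1 by lia.
  have -> : i.+1 + 2 * (j - i) = k.+1 by lia.
  by rewrite subn_gt0 /interval1 !mem_iota; split; [|split|split]; try tauto; lia.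
move=> i j k e iN kN; have [ij|ji|<-] := ltngtP i j; last by left.
  exact: key ij e kN.
by have := key k j i ltac:(lia) ltac:(lia) iN; intuition.
Qed.

Lemma color_class_le n c v : size (color_class n c v) <= largest_class n c.
Proof.
have [/eqP -> //|] := boolP (size (color_class n c v) == 0).
rewrite size_eq0 -has_filter => /hasP[i hi /eqP <-].
by rewrite /largest_class (big_rem i) //= leq_maxl.
Qed.

Lemma f_lower n : 0 < n -> 8 * n <= 17 * f n + 8 \/ 3 * n <= 6 * f n + 29.
Proof.
case: n => // N _; rewrite /f; case: ex_minnP => k /asboolP[c [rf <-]] _.
have hL v : count (fun i => c i.+1 == v) (iota 0 N.+1) <= largest_class N.+1 c.
  apply: leq_trans (color_class_le N.+1 c v).
  have e : iota 1 N.+1 = [seq 1 + i | i <- iota 0 N.+1] := iotaDl 1 0 N.+1.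
  by rewrite /color_class /interval1 size_filter e count_map.
by have := large_class (rainbow_free_no_rainbow rf) hL; lia.
Qed.

Definition qr17 i : nat :=
  if i %% 17 == 0 then 0 else if i %% 17 \in [:: 1; 2; 4; 8; 9; 13; 15; 16] then 1 else 2.

Lemma qr17_rainbow_free n : rainbow_free n qr17.
Proof.
case=> a [d [d0 _ [h1 h2 h3]]].
have chk : all (fun a => all (fun d =>
    [|| qr17 a == qr17 (a + d), qr17 a == qr17 (a + 2 * d) | qr17 (a + d) == qr17 (a + 2 * d)])
    (iota 0 17)) (iota 0 17) by vm_compute.
have mE i : qr17 (i %% 17) = qr17 i by rewrite /qr17 modn_mod.
have := allP chk (a %% 17); rewrite mem_iota ltn_mod => /(_ isT) /allP /(_ (d %% 17)).
rewrite mem_iota ltn_mod => /(_ isT).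
have -> : qr17 (a %% 17) = qr17 a by rewrite mE.
have -> : qr17 (a %% 17 + d %% 17) = qr17 (a + d) by rewrite -mE modnDm mE.
have -> : qr17 (a %% 17 + 2 * (d %% 17)) = qr17 (a + 2 * d).
  by rewrite -mE -modnDmr modnMmr modnDm mE.
by case/or3P => /eqP.
Qed.

(** A full period has 8 points in each large class; for the last incomplete
period the bound is checked on the 17 possible lengths. *)
Lemma qr17_count n v : 17 * count (fun i => qr17 i == v) (iota 1 n) <= 8 * n + 25.
Proof.
elim/ltn_ind: n => n IH; have [n17|n17] := ltnP n 17.
  have [v3|v3] := ltnP v 3; last first.
    rewrite (_ : count _ _ = 0) //; apply/eqP; rewrite -leqn0 leqNgt -has_count.
    apply/hasPn => i _; apply/eqP; rewrite /qr17; case: ifP => _; [lia|case: ifP; lia].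
  have chk : all (fun n => all (fun v =>
      17 * count (fun i => qr17 i == v) (iota 1 n) <= 8 * n + 25) (iota 0 3)) (iota 0 17).
    by vm_compute.
  have := allP chk n; rewrite mem_iota => /(_ n17) /allP /(_ v).
  by rewrite mem_iota => /(_ v3).
have := IH (n - 17) ltac:(lia).
rewrite -[in iota 1 n](subnKC n17) iotaD count_cat.
have per k : count (fun i => qr17 i == v) (iota (1 + 17) k) = count (fun i => qr17 i == v) (iota 1 k).
  rewrite addnC iotaDl count_map; apply: eq_count => i /=.
  by rewrite /qr17 (_ : 17 + i = i + 17) ?modnDr // addnC.
rewrite per; have : count (fun i => qr17 i == v) (iota 1 17) <= 8.
  case: v {IH per} => [|[|[|v]]]; [by vm_compute..|].
  rewrite leqNgt; apply/negP => h; have : 0 < count (fun i => qr17 i == v.+3) (iota 1 17) by lia.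
  rewrite -has_count => /hasP[i _]; rewrite /qr17; case: ifP => _ //; case: ifP => //.
lia.
Qed.

Lemma f_upper n : 17 * f n <= 8 * n + 25.
Proof.
rewrite /f; case: ex_minnP => k _ kmin.
have : k <= largest_class n qr17.
  by apply: kmin; apply/asboolP; exists qr17; split=> //; apply: qr17_rainbow_free.
move=> /(leq_mul (leqnn 17)) h; apply: leq_trans h _.
rewrite /largest_class; elim/big_ind: _ => [|x y hx hy|i _].
- lia.
- by rewrite maxnMr geq_max hx.
- by rewrite /color_class size_filter; apply: qr17_count.
Qed.

Import Order.TTheory GRing.Theory Num.Theory.
Local Open Scope ring_scope.

Theorem corollary1 :
  (forall n : nat, (2600 <= n)%N ->
     Num.ceil (8 * (n%:R - 1) / 17 : rat) <= (f n)%:Z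
     /\ (f n)%:Z <= Num.ceil (8 * (n%:R - 1) / 17 : rat) + 1)
  /\
  (forall n : nat, (1 <= n)%N ->
     8 * (n%:R - 1) / 17 - 4 <= (f n)%:R :> rat
     /\ (f n)%:R <= 8 * (n%:R - 1) / 17 + 2 :> rat).
Proof.
have up n : 17 * (f n)%:R <= 8 * n%:R + 25 :> rat.
  by have := f_upper n; rewrite -(ler_nat rat) natrD !natrM.
split=> n hn; have := up n; have lo := f_lower (n := n) ltac:(lia).
- have {lo} : (8 * n <= 17 * f n + 8)%N by lia.
  rewrite -(ler_nat rat) natrD !natrM => lo hi; split.
    by rewrite ceil_le_int -pmulrn; lra.
  have : (f n)%:Z - 2 < Num.ceil (8 * (n%:R - 1) / 17 : rat).
    by rewrite ceil_gt_int rmorphB /= -pmulrn; lra.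
  lia.
- have {lo} : (8 * n <= 17 * f n + 76)%N by lia.
  rewrite -(ler_nat rat) natrD !natrM => lo hi; split; lra.
Qed.
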